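(* Let $K=\mathbb{F}_q$ be a finite field, let $S=K[t_1,\ldots,t_s]$, and let $I=I(T)$ be the vanishing ideal of the affine torus $T=(\mathbb{F}_q^* )^s$. If $q\geq 3$ and $\prec$ is a graded monomial order on $S$, then $$ \rho_{I}(d,r)\leq\delta_r(\mathcal{C}_{\leq d})\quad\mbox{for } d\geq 1\mbox{ and }1\leq r\leq\dim_K(\mathcal{C}_{\leq d}). $$
   Context: $I(T)$ is the set of all $f\in S$ vanishing at every point of $T$. A monomial order is graded if monomials are first compared by total degree; ${\rm in}_\prec(I)$ is the initial ideal of $I$. Let $V_{\leq d}$ be the set of all squarefree monomials of $S$ of degree at most $d$ (including $1$), and $KV_{\leq d}$ its $K$-span. Write $T=\{P_1,\ldots,P_m\}$. The squarefree evaluation code $\mathcal{C}_{\leq d}\subset K^m$ of degree $d$ on $T$ is the image of $KV_{\leq d}\to K^m$, $f\mapsto(f(P_1),\ldots,f(P_m))$. $\mathcal{J}_{\prec,d,r}$ is the family of all sets $M=\{t^{a_1},\ldots,t^{a_r}\}$ of $r$ distinct squarefree monomials of $S$ of degree at most $d$. The $r$-th squarefree footprint of $\mathcal{C}_{\leq d}$ is $$ \rho_I(d,r):=\deg(S/I)-\max\{\deg(S/({\rm in}_\prec(I),M))\mid M\in\mathcal{J}_{\prec,d,r}\}, $$ where $({\rm in}_\prec(I),M)$ is the ideal generated by ${\rm in}_\prec(I)\cup M$. For an ideal $J\subset S$, let $H_J^a(d)=\dim_K(S_{\leq d}/J_{\leq d})$, where $S_{\leq d}$, $J_{\leq d}$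 are the polynomials of degree at most $d$ in $S$, $J$. If $J\subsetneq S$ and $k=\dim(S/J)$ (Krull dimension), then for $d\gg0$ $H_J^a(d)$ is a polynomial in $d$ of degree $k$ with leading coefficient $a_k$, and $\deg(S/J)=k!\,a_k$; $\deg(S/J)=0$ if $J=S$. In particular, if $k=0$, then $\deg(S/J)=\dim_K(S/J)$. For a linear code $C\subset K^m$ and $1\leq r\leq\dim_K C$, $\delta_r(C)=\min\{|\chi(D)| : D \text{ a linear subspace of } C,\ \dim_K D=r\}$, where $\chi(D)=\{i : \exists\,(a_1,\ldots,a_m)\in D,\ a_i\neq 0\}$. *)

(* Defs.v *)
From HB Require Import structures.
From mathcomp Require Import all_boot all_order all_algebra.
From mathcomp Require Import boolp classical_sets.
From mathcomp Require Import mpoly.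

Set Implicit Arguments.
Unset Strict Implicit.
Unset Printing Implicit Defensive.

Import Order.TTheory GRing.Theory Num.Theory.

Local Open Scope classical_set_scope.
Local Open Scope ring_scope.

(* S = K[t_1, ..., t_s] is {mpoly K[s]}; ideals of S are classical sets. *)

Section Ideals.
Variables (K : fieldType) (s : nat).
Local Notation S := {mpoly K[s]}.
Implicit Types (G J : set S).

Definition ideal_gen G : set S :=
  [set f | exists hs : seq (S * S),
     (forall p, p \in hs -> G p.2) /\ f = \sum_(p <- hs) p.1 * p.2].

(* [idealr_closed] includes 1 \notin P, so P is a proper ideal. *)
Definition prime_ideal (P : set S) : Prop :=
  idealr_closed (fun f : S => f \in P) /\
  prime_idealr_closed (fun f : S => f \in P).

(* There are primes P 0 < P 1 < ... < P n of S containing J, i.e. a chain of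
   primes of length n in S / J. *)
Definition prime_chain J (n : nat) : Prop :=
  exists P : nat -> set S,
    (forall i, (i <= n)%N -> prime_ideal (P i) /\ J `<=` P i) /\
    (forall i, (i < n)%N -> P i `<` P i.+1).

(* Krull dimension of S / J; the value is meaningful only for J a proper
   ideal. *)
Definition krull_dim J : nat :=
  xget 0%N [set k | prime_chain J k /\
                    forall n, prime_chain J n -> (n <= k)%N].

Definition monomial_order (le : rel 'X_{1..s}) : Prop :=
  [/\ antisymmetric le, transitive le, total le,
      (forall m, le 0%MM m) &
      (forall m1 m2 m, le m1 m2 -> le (m1 + m)%MM (m2 + m)%MM)].

Definition graded (le : rel 'X_{1..s}) : Prop :=
  forall m1 m2, (mdeg m1 < mdeg m2)%N -> le m1 m2.

Definition is_lead_mon (le : rel 'X_{1..s}) (f : S) (m : 'X_{1..s}) : Prop :=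
  m \in msupp f /\ forall m', m' \in msupp f -> le m' m.

(* The zero polynomial of I has no leading monomial, hence contributes no
   generator. *)
Definition initial_ideal (le : rel 'X_{1..s}) (I : set S) : set S :=
  ideal_gen [set g | exists f m, [/\ I f, is_lead_mon le f m & g = 'X_[m]]].

End Ideals.

Section Degree.
Variables (K : finFieldType) (s : nat).
Local Notation S := {mpoly K[s]}.

(* The vector space S_{<= d}, as coefficient functions on the monomials of
   degree at most d. *)
Definition bpoly (d : nat) := {ffun 'X_{1..s < d.+1} -> K^o}.

Definition mpoly_of (d : nat) (v : bpoly d) : S :=
  \sum_(m : 'X_{1..s < d.+1}) (v m : K) *: 'X_[m].

(* J_{<= d} as a subspace of S_{<= d}; when J is an ideal the spanning set is
   already a subspace. *)
Definition truncation (J : set S) (d : nat) : {vspace bpoly d} :=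
  <<(enum [pred v : {ffun 'X_{1..s < d.+1} -> K} | mpoly_of v \in J]
      : seq (bpoly d))>>%VS.

(* dim_K (S_{<= d} / J_{<= d}) *)
Definition affine_hilbert (J : set S) (d : nat) : nat :=
  (\dim {: bpoly d} - \dim (truncation J d))%N.

(* The polynomial agreeing with affine_hilbert J for all large d; there is at
   most one. *)
Definition affine_hilbert_poly (J : set S) : {poly rat} :=
  xget 0 [set p : {poly rat} | exists d0, forall d, (d0 <= d)%N ->
                                 p.[d%:R] = (affine_hilbert J d)%:R].

(* deg (S / J) = k! a_k, with k = dim (S / J) and a_k the coefficient of degree
   k of the affine Hilbert polynomial. *)
Definition degree (J : set S) : rat :=
  if `[< J = setT >] then 0
  else ((krull_dim J)`!)%:R * (affine_hilbert_poly J)`_(krull_dim J).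

End Degree.

Section Codes.
Variables (K : finFieldType).

Definition code_support (m : nat) (D : {vspace 'rV[K]_m}) : {set 'I_m} :=
  [set i | [exists v : 'rV[K]_m, (v \in D) && (v 0 i != 0)]]%SET.

(* The r-th generalized Hamming weight.  Supports have at most m elements, so
   for 1 <= r <= \dim C the default value m does not affect the minimum. *)
Definition gen_hamming_weight (m : nat) (C : {vspace 'rV[K]_m}) (r : nat) :
    nat :=
  \big[minn/m]_(w < m.+1 | `[< exists D : {vspace 'rV[K]_m},
      [/\ (D <= C)%VS, \dim D = r & #|code_support D| = w] >]) w.

Variable (s : nat).
Local Notation S := {mpoly K[s]}.
Local Notation point := {ffun 'I_s -> K}.

Definition affine_torus : {set point} :=
  [set P : point | [forall i, P i != 0]]%SET.

Definition vanishing_ideal (T : {set point}) : set S :=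
  [set f | forall P, P \in T -> f.@[P] = 0].

Definition sqfree_monomials (d : nat) : {set 'X_{1..s < d.+1}} :=
  [set m : 'X_{1..s < d.+1} | [forall i, (bmnm m i <= 1)%N]]%SET.

Definition sqfree_space (d : nat) : {vspace bpoly K s d} :=
  <<[seq ([ffun m' => (m' == m)%:R] : bpoly K s d)
        | m <- enum (sqfree_monomials d)]>>%VS.

Definition evaluation (T : {set point}) (d : nat) (v : bpoly K s d) :
    'rV[K]_#|T| :=
  \row_(i < #|T|) (mpoly_of v).@[(enum_val i : point)].

Lemma evaluation_is_linear (T : {set point}) (d : nat) :
  linear (@evaluation T d).
Proof.
move=> a u v; apply/rowP=> i; rewrite !mxE -mevalZ -mevalD; congr meval.
rewrite /mpoly_of scaler_sumr -big_split /=; apply: eq_bigr => m _.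
by rewrite !ffunE scalerDl scalerA.
Qed.

HB.instance Definition _ (T : {set point}) (d : nat) :=
  GRing.isLinear.Build K (bpoly K s d) 'rV[K]_#|T| _ (@evaluation T d)
    (@evaluation_is_linear T d).

Definition sqfree_code (T : {set point}) (d : nat) : {vspace 'rV[K]_#|T|} :=
  (linfun (@evaluation T d) @: sqfree_space d)%VS.

Definition monomials_of (d : nat) (M : {set 'X_{1..s < d.+1}}) : set S :=
  [set g | exists2 m : 'X_{1..s < d.+1}, m \in M & g = 'X_[m]].

(* Degrees are nonnegative, so the default value 0 does not affect the maximum
   as long as the family of sets M is nonempty. *)
Definition sqfree_footprint (le : rel 'X_{1..s}) (I : set S) (d r : nat) :
    rat :=
  degree I -
  \big[Order.max/0]_(M : {set 'X_{1..s < d.+1}}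
                      | (M \subset sqfree_monomials d) && (#|M| == r))
     degree (ideal_gen (initial_ideal le I `|` monomials_of M)).

End Codes.

Arguments affine_torus : clear implicits.

(* Main.v *)
(* Let D be an r-dimensional subcode, X the points of T at which all of D
   vanishes, and W the squarefree polynomials of degree at most d whose
   evaluation lies in D.  The leading coefficients separate the elements of W,
   so W has at least r distinct leading monomials, all squarefree; let M consist
   of r of them.  Every monomial of J = (in(I), M) is the leading monomial of a
   polynomial vanishing on X, so reduction along the order rewrites every
   function on X as a combination of monomials outside J.  Hence
   |T| - |chi(D)| = |X| <= dim_K (S/J).  Both I and J contain, up to
   lower-order terms, every t_i^(q-1), so S/I and S/J are finite: they have Krull
   dimension 0 and their degree is their K-dimension. *)
From HB Require Import structures.
Require Import Defs.
From mathcomp Require Import all_boot all_order all_algebra.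
From mathcomp Require Import finfield boolp classical_sets mpoly.

Set Implicit Arguments.
Unset Strict Implicit.
Unset Printing Implicit Defensive.

Import Order.TTheory GRing.Theory Num.Theory.
Local Open Scope ring_scope.

(** [p - c%:P] has as many distinct roots as its size, one more than a nonzero polynomial allows.
    This identifies the affine Hilbert polynomial. *)
Lemma eventually_const_polyP (p : {poly rat}) (c : rat) (d0 : nat) :
  (forall d, (d0 <= d)%N -> p.[d%:R] = c) -> p = c%:P.
Proof.
move=> pE; apply/eqP; rewrite -subr_eq0; apply/eqP.
pose rs : seq rat := [seq n%:R | n <- iota d0 (size (p - c%:P))].
apply: (@roots_geq_poly_eq0 _ _ rs); last by rewrite size_map size_iota.
  apply/allP => x /mapP [n]; rewrite mem_iota => /andP[/pE Hn _] ->.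
  by rewrite rootE !hornerE Hn subrr.
by rewrite map_inj_uniq ?iota_uniq //; apply: mulrIn; rewrite oner_eq0.
Qed.

(** * Coefficient vectors as polynomials of bounded degree *)

Section MpolyOf.
Variables (K : finFieldType) (s d : nat).

Lemma mpoly_of_is_linear : linear (@mpoly_of K s d).
Proof.
move=> a u v; rewrite /mpoly_of scaler_sumr -big_split /=.
by apply: eq_bigr => m _; rewrite !ffunE scalerDl scalerA.
Qed.

HB.instance Definition _ := GRing.isLinear.Build K (bpoly K s d) {mpoly K[s]} _
  (@mpoly_of K s d) mpoly_of_is_linear.

Lemma mcoeff_mpoly_of (v : bpoly K s d) (m : 'X_{1..s < d.+1}) :
  (mpoly_of v)@_m = v m.
Proof.
rewrite raddf_sum (bigD1 m) //= mcoeffZ mcoeffX eqxx mulr1.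
rewrite big1 ?addr0 // => i nim.
by rewrite mcoeffZ mcoeffX -bmeqP (negbTE nim) mulr0.
Qed.

Lemma mcoeff_mpoly_of_eq0 (v : bpoly K s d) (m : 'X_{1..s}) :
  (d < mdeg m)%N -> (mpoly_of v)@_m = 0.
Proof.
move=> dm; rewrite raddf_sum big1 // => i _ /=; rewrite mcoeffZ mcoeffX.
case: eqP => [im|_]; last by rewrite mulr0.
by have := bmdeg i; rewrite im ltnNge dm.
Qed.

Lemma mpoly_of_mcoeff (f : {mpoly K[s]}) :
  (msize f <= d.+1)%N ->
  mpoly_of ([ffun m : 'X_{1..s < d.+1} => f@_m] : bpoly K s d) = f.
Proof.
move=> fd; rewrite [RHS](@mpolywE _ _ d.+1) //.
by apply: eq_bigr => m _; rewrite ffunE.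
Qed.

End MpolyOf.

(** * Degree of J when a linear map [phi] identifies S/J with K^n *)

Section ZeroDimensional.
Variables (K : finFieldType) (s n : nat).
Local Notation S := {mpoly K[s]}.
Variables (phi : {linear S -> 'rV[K]_n}) (J : set S).
Hypothesis kerJ : forall f, J f <-> phi f = 0.
Hypothesis phi_onto : forall y, exists f, phi f = y.

(** [phi] embeds S_{<=d} / J_{<=d} into K^n. Since K^n is finite, chosen preimages of all its
    vectors have bounded degree, so for large d the embedding is onto. *)
Lemma affine_hilbert_ker :
  exists d0, forall d, (d0 <= d)%N -> affine_hilbert J d = n.
Proof.
have [g gE] := fin_all_exists phi_onto.
exists (\max_(y : 'rV[K]_n) msize (g y)) => d le_d.
pose psi := linfun (phi \o @mpoly_of K s d).
(* Rank-nullity: the truncation of J is the kernel of [psi]. *)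
have -> : affine_hilbert J d = \dim (limg psi).
  rewrite /affine_hilbert -(limg_ker_dim psi fullv) capfv.
  suff -> : truncation J d = lker psi by rewrite addKn.
  apply/eqP; rewrite eqEsubv; apply/andP; split.
    apply/span_subvP => v; rewrite mem_enum inE => /kerJ v0.
    by rewrite memv_ker lfunE /= v0.
  apply/subvP => v; rewrite memv_ker lfunE /= => /eqP v0; apply: memv_span.
  by rewrite mem_enum inE; apply/kerJ.
suff -> : limg psi = fullv by rewrite dimvf /dim /= mul1n.
apply/eqP; rewrite eqEsubv subvf; apply/subvP => y _.
apply/memv_imgP; exists ([ffun m : 'X_{1..s < d.+1} => (g y)@_m] : bpoly K s d).
  exact: memvf.
rewrite lfunE /= mpoly_of_mcoeff ?gE //.
by apply/(leq_trans _ (leq_trans le_d _)); rewrite ?(leq_bigmax y).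
Qed.

Lemma affine_hilbert_poly_ker : affine_hilbert_poly J = (n%:R)%:P.
Proof.
have [d0 Hd0] := affine_hilbert_ker.
apply: xget_unique => [|p [d1 pE]].
  by exists d0 => d /Hd0 ->; rewrite hornerC.
apply: (@eventually_const_polyP _ _ (maxn d0 d1)) => d.
by rewrite geq_max => /andP[/Hd0 h /pE ->]; rewrite h.
Qed.

(* S / J is finite, so f ^+ i - f ^+ j lies in J for some i < j; modulo a prime
   containing J this forces f = 0 or f ^+ (j - i) = 1. *)
Lemma prime_over_ker_maximal (P Q : set S) :
  prime_ideal P -> prime_ideal Q -> (J `<=` P)%classic ->
  (P `<=` Q)%classic -> (Q `<=` P)%classic.
Proof.
move=> [[P0 P1 PM] Ppr] [[Q0 Q1 QM] Qpr] JP PQ f Qf.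
apply: contrapT => nPf.
have nPX k : f ^+ k \notin P.
  elim: k => [|k IH]; first by rewrite expr0.
  apply/negP; rewrite exprS => /Ppr /orP[|]; last by apply/negP.
  by rewrite in_setE.
have [i [j [ltij eij]]] : exists i j, (i < j)%N /\ phi (f ^+ i) = phi (f ^+ j).
  pose h (i : 'I_(#|{: 'rV[K]_n}|.+1)) := phi (f ^+ i).
  have /injectivePn [i [j nij hij]] : ~~ injectiveb h.
    apply/injectiveP => /leq_card; rewrite card_ord ltnn //.
  by case: (ltngtP i j) (nij) => [lt|lt|/val_inj ->]; rewrite ?eqxx // => _;
    [exists i, j | exists j, i].
have : f ^+ i * (1 - f ^+ (j - i)) \in P.
  rewrite in_setE; apply/JP/kerJ.
  by rewrite mulrBr mulr1 -exprD subnKC 1?ltnW // linearB /= eij subrr.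
move=> /Ppr /orP[|Pb]; first by apply/negP.
have Qb : 1 - f ^+ (j - i) \in Q by move: Pb; rewrite !in_setE => /PQ.
have QX : f ^+ (j - i) \in Q.
  have -> : (j - i = (j - i).-1.+1)%N by rewrite prednK ?subn_gt0.
  by rewrite exprSr -[_ * f]addr0; apply: QM => //; rewrite in_setE.
by have := QM 1 _ _ Qb QX; rewrite mul1r subrK; apply/negP.
Qed.

Variable c : 'I_s -> K.
Hypothesis J_c : forall f, J f -> f.@[c] = 0.

Lemma point_ideal_prime : prime_ideal [set f : S | f.@[c] = 0]%classic.
Proof.
split; first split.
- by rewrite in_setE /= meval0.
- by rewrite notin_setE /= meval1; apply/eqP/oner_neq0.
- move=> a u v; rewrite !in_setE /= => u0 v0.
  by rewrite mevalD mevalM u0 v0 mulr0 addr0.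
move=> u v; rewrite in_setE /= mevalM => /eqP; rewrite mulf_eq0.
by case/orP => /eqP ?; apply/orP; [left|right]; rewrite in_setE.
Qed.

(** The ideal of the point [c] is a prime over J, hence a chain of length 0; a longer chain would
    contain a strict inclusion of primes over J, which [prime_over_ker_maximal] excludes. *)
Lemma krull_dim_ker : krull_dim J = 0%N.
Proof.
apply: xget_unique => [|k [Ck Hk]].
  split.
    exists (fun=> [set f : S | f.@[c] = 0]%classic); split => // i _.
    by split; [exact: point_ideal_prime | exact: J_c].
  move=> n0 [P [PP Plt]]; rewrite leqNgt; apply/negP => n0_gt0.
  have [P01 nP] := Plt _ n0_gt0; apply: nP.
  have [pr0 J0] := PP 0%N isT; have [pr1 _] := PP 1%N n0_gt0.
  exact: prime_over_ker_maximal pr0 pr1 J0 P01.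
case: k Ck Hk => // k [P [PP Plt]] _.
have [P01 nP] := Plt 0%N isT; case: nP.
have [pr0 J0] := PP 0%N isT; have [pr1 _] := PP 1%N isT.
exact: prime_over_ker_maximal pr0 pr1 J0 P01.
Qed.

(** The common zero [c] also makes J proper, which rules out the special case of [degree]. *)
Lemma degree_ker : degree J = n%:R.
Proof.
rewrite /degree; case: asboolP => [JT|_]; last first.
  by rewrite krull_dim_ker affine_hilbert_poly_ker coefC eqxx fact0 mul1r.
have := @J_c 1; rewrite JT meval1 => /(_ I) /eqP.
by rewrite oner_eq0.
Qed.

End ZeroDimensional.

(** * Interpolation and the degree of a vanishing ideal *)

Section EvaluationMap.
Variables (K : finFieldType) (s : nat).
Local Notation S := {mpoly K[s]}.
Local Notation point := {ffun 'I_s -> K}.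

Lemma mpoly_interpolation (g : point -> K) :
  exists f : S, forall Q : point, f.@[Q] = g Q.
Proof.
(* Indicator of P: by Fermat, a nonzero difference has (q-1)-th power 1, so each factor is 1 at a
   matching coordinate and 0 elsewhere. *)
pose ind (P : point) : S := \prod_i (1 - ('X_i - (P i)%:MP) ^+ #|K|.-1).
have indE (P Q : point) : (ind P).@[Q] = (P == Q)%:R.
  rewrite /ind rmorph_prod /=; under eq_bigr => i _ do
    rewrite mevalB meval1 rmorphXn /= mevalB mevalXU mevalC.
  have q_gt1 := card_finNzRing_gt1 K.
  case: eqP => [->|/eqP].
    rewrite big1 // => i _; rewrite subrr expr0n.
    by rewrite -subn1 subn_eq0 leqNgt q_gt1 subr0.
  apply: contraNeq => /prodf_neq0 h; apply/eqP/ffunP => i.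
  have := h i isT; apply: contraNeq => nPQ.
  rewrite subr_eq0 eq_sym; apply/eqP.
  have d0 : Q i - P i != 0 by rewrite subr_eq0 eq_sym.
  by apply: (mulfI d0); rewrite -exprS prednK 1?ltnW // expf_card mulr1.
exists (\sum_P g P *: ind P) => Q; rewrite raddf_sum (bigD1 Q) //= big1.
  by rewrite addr0 mevalZ indE eqxx mulr1.
by move=> P nPQ; rewrite mevalZ indE (negbTE nPQ) mulr0.
Qed.

Definition evalrow (T : {set point}) (f : S) : 'rV[K]_#|T| :=
  \row_(i < #|T|) f.@[enum_val i : point].

Lemma evalrow_is_linear (T : {set point}) : linear (evalrow T).
Proof. by move=> a u v; apply/rowP => i; rewrite !mxE mevalD mevalZ. Qed.

HB.instance Definition _ (T : {set point}) :=
  GRing.isLinear.Build K S 'rV[K]_#|T| _ (evalrow T) (@evalrow_is_linear T).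

(** Evaluation on T has kernel I(T) and is onto by interpolation. The point [c] serves both as
    common zero and as default for [enum_rank_in]. *)
Lemma degree_vanishing_ideal (T : {set point}) (c : point) :
  c \in T -> degree (vanishing_ideal T) = #|T|%:R.
Proof.
move=> cT; apply: (@degree_ker _ _ _ (evalrow T) _ _ _ c) => [f|y|f]; last first.
- by apply.
- have [f fE] := mpoly_interpolation (fun Q => y 0 (enum_rank_in cT Q)).
  by exists f; apply/rowP => i; rewrite mxE fE enum_valK_in.
split=> [f0|f0 P PT]; first by apply/rowP => i; rewrite !mxE f0 // enum_valP.
by have /rowP/(_ (enum_rank_in PT P)) := f0; rewrite !mxE enum_rankK_in.
Qed.

End EvaluationMap.

(** * Monomial ideals and their standard monomials *)

Section MonomialIdeals.
Variables (K : finFieldType) (s : nat).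
Local Notation S := {mpoly K[s]}.

(* [G] need not consist of monomials only, so that the lemma also applies when
   [G] contains a whole monomial ideal such as the initial ideal. *)
Lemma ideal_gen_monomials (A : set 'X_{1..s}) (G : set S) :
  (forall a, A a -> G 'X_[a]) ->
  (forall g, G g -> forall m, m \in msupp g -> exists2 a, A a & (a <= m)%MM) ->
  forall f, ideal_gen G f <->
    forall m, m \in msupp f -> exists2 a, A a & (a <= m)%MM.
Proof.
move=> AG GA f; split=> [[hs [hsG ->]] m|fA].
  move=> /msupp_sum_le /flattenP [t /mapP [p]].
  rewrite filter_predT => php -> /msuppM_le /allpairsP [[m1 m2] /= [_ m2p ->]].
  have [a Aa am2] := GA _ (hsG _ php) _ m2p; exists a => //.
  exact: lepm_trans am2 (lem_addl _ _).
have /choice [a aE] (m : 'X_{1..s}) :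
    exists a, m \in msupp f -> A a /\ (a <= m)%MM.
  have [/fA [a Aa am]|nm] := boolP (m \in msupp f); first by exists a.
  by exists 0%MM.
exists [seq (f@_m *: 'X_[m - a m], 'X_[a m]) | m <- msupp f]; split.
  by move=> p /mapP [m /aE [Aa _] ->]; apply: AG.
rewrite big_map {1}[f]mpolyE; apply: eq_big_seq => m /aE [_ am] /=.
by rewrite -scalerAl -mpolyXD submK.
Qed.

Definition coefrow (B : nat) (N : {set 'X_{1..s < B}}) (f : S) : 'rV[K]_#|N| :=
  \row_(i < #|N|) f@_(enum_val i : 'X_{1..s < B}).

Lemma coefrow_is_linear B (N : {set 'X_{1..s < B}}) : linear (coefrow N).
Proof. by move=> a u v; apply/rowP => i; rewrite !mxE mcoeffD mcoeffZ. Qed.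

HB.instance Definition _ B (N : {set 'X_{1..s < B}}) :=
  GRing.isLinear.Build K S 'rV[K]_#|N| _ (coefrow N) (@coefrow_is_linear B N).

Lemma coefrow_eq0 B (N : {set 'X_{1..s < B}}) f (m : 'X_{1..s < B}) :
  coefrow N f = 0 -> m \in N -> f@_m = 0.
Proof.
move=> /rowP h mN; have := h (enum_rank_in mN m).
by rewrite !mxE enum_rankK_in.
Qed.

Lemma sum_coefrow B (N : {set 'X_{1..s < B}}) (y : 'rV[K]_#|N|) (i : 'I_#|N|) :
  (\sum_j y 0 j *: 'X_[(enum_val j : 'X_{1..s < B})] : S)@_(enum_val i) = y 0 i.
Proof.
rewrite raddf_sum (bigD1 i) //= mcoeffZ mcoeffX eqxx mulr1 big1 ?addr0 // => j nji.
by rewrite mcoeffZ mcoeffX -bmeqP (inj_eq enum_val_inj) (negbTE nji) mulr0.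
Qed.

Section StandardMonomials.
Variables (J : set S) (U : pred 'X_{1..s}) (B : nat).
Hypothesis JU : forall f, J f <-> forall m, m \in msupp f -> U m.
Hypothesis U_add : forall m1 m2, U m1 -> U (m1 + m2)%MM.
Hypothesis U_large : forall m, (B <= mdeg m)%N -> U m.
Let N : {set 'X_{1..s < B}} := [set m | ~~ U (bmnm m)]%SET.

(** Reading off the coefficients at the standard monomials has kernel J, because [U_large] puts
    every standard monomial in the finite set [N]. The required common zero is the origin. *)
Lemma degree_monomial_ideal : degree J = #|N|%:R.
Proof.
(* If J contains 1 it has no zero, so this case is separate: J = S, and both sides are 0. *)
have [U0|nU0] := boolP (U 0%MM).
  have UT m : U m by rewrite -[m]add0m U_add.
  have -> : J = setT by apply/seteqP; split=> // f _; apply/JU.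
  rewrite /degree asboolT // (_ : N = finset.set0) ?cards0 //.
  by apply/setP => m; rewrite !inE UT.
apply: (@degree_ker _ _ _ (coefrow N) _ _ _ (fun=> 0)) => [f|y|f].
- split=> [/JU fU|f0]; last first.
    apply/JU => m mf; apply/negPn/negP => nUm; move: mf.
    rewrite mcoeff_msupp; have [/U_large Um|mB] := leqP B (mdeg m).
      by rewrite Um in nUm.
    by rewrite (@coefrow_eq0 _ N f (BMultinom mB)) ?eqxx // inE.
  apply/rowP => i; rewrite !mxE; apply/eqP; rewrite mcoeff_eq0.
  by apply/negP => /fU; apply/negP; have := enum_valP i; rewrite inE.
- exists (\sum_j y 0 j *: 'X_[(enum_val j : 'X_{1..s < B})]).
  by apply/rowP => i; rewrite mxE sum_coefrow.
move=> /JU fU; rewrite mevalE big_seq big1 // => m /fU Um.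
have m0 : m != 0%MM by apply: contraTneq Um => ->.
have [i mi] : exists i, m i != 0%N.
  apply/existsP; apply: contraNT m0; rewrite negb_exists => /forallP h.
  by apply/eqP/mnmP => i; have := h i; rewrite mnm0E negbK => /eqP.
by rewrite (bigD1 i) //= expr0n (negbTE mi) mul0r mulr0.
Qed.

End StandardMonomials.
End MonomialIdeals.

(** * Graded monomial orders and reduction to standard monomials *)

Section MonomialOrder.
Variables (s : nat) (le : rel 'X_{1..s}).
Hypotheses (le_mon : monomial_order le) (le_gr : graded le).

(** Well-foundedness comes from gradedness: a monomial has only finitely many below it, all of no
    larger degree. The induction is on their number. *)
Lemma graded_order_ind (P : 'X_{1..s} -> Prop) :
  (forall m, (forall m', le m' m -> m' != m -> P m') -> P m) -> forall m, P m.
Proof.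
(* The bound [B] stays fixed during the descent, so that all the sets [below m] lie in one finite
   type. *)
have [le_anti le_trans le_tot _ _] := le_mon.
move=> IH m0; pose B := (mdeg m0).+1.
pose below (m : 'X_{1..s}) := [set m' : 'X_{1..s < B} | le (bmnm m') m]%SET.
suff H n : forall m, (mdeg m < B)%N -> (#|below m| < n)%N -> P m.
  exact: (H #|below m0|.+1).
elim: n => // n IHn m mB; rewrite ltnS => card_m; apply: IH => m' le_m'm nm'm.
have m'B : (mdeg m' < B)%N.
  apply: leq_ltn_trans mB; rewrite leqNgt; apply/negP => /le_gr le_mm'.
  by move: nm'm; rewrite (@le_anti m' m) ?eqxx // le_m'm.
apply: IHn => //; apply: leq_trans card_m; apply: proper_card.
apply/properP; split.
  by apply/fintype.subsetP => a; rewrite !inE => /le_trans; apply.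
exists (BMultinom mB); rewrite !inE /=; first by have := le_tot m m; rewrite orbb.
by apply: contra nm'm => le_mm'; apply/eqP/le_anti; rewrite le_m'm.
Qed.

Variable K : finFieldType.
Local Notation S := {mpoly K[s]}.
Local Notation point := {ffun 'I_s -> K}.

Lemma lead_mon_exists (f : S) : f != 0 -> exists m, is_lead_mon le f m.
Proof.
have [_ le_trans le_tot _ _] := le_mon.
rewrite -msupp_eq0 /is_lead_mon; elim: (msupp f) => // m [|m1 t] IH _.
  exists m; rewrite mem_head; split=> // m'; rewrite inE => /eqP ->.
  by have := le_tot m m; rewrite orbb.
have [//|m2 [m2t m2max]] := IH; have /orP[le_m|le_m] := le_tot m m2.
  exists m2; rewrite inE m2t orbT; split=> // m'.
  by rewrite inE => /orP[/eqP ->|/m2max].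
exists m; rewrite mem_head; split=> // m'; rewrite inE => /orP[/eqP ->|/m2max].
  by have := le_tot m m; rewrite orbb.
by move=> /le_trans; apply.
Qed.

Lemma lead_monMX (f : S) m a :
  is_lead_mon le f m -> is_lead_mon le (f * 'X_[a]) (m + a)%MM.
Proof.
have [_ _ _ _ le_add] := le_mon.
move=> [mf mmax]; split=> [|m'].
  by rewrite mcoeff_msupp addmC mcoeffMX -mcoeff_msupp.
rewrite (perm_mem (msuppMX _ _)) => /mapP [m1 m1f ->].
by rewrite addmC; apply/le_add/mmax.
Qed.

Section Reduction.
Variables (X : {set point}) (U : pred 'X_{1..s}).
Hypothesis U_lead : forall m, U m ->
  exists2 f : S, is_lead_mon le f m & forall P, P \in X -> f.@[P] = 0.

(** On X, a monomial in U equals a combination of smaller ones, obtained from the polynomial that it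
    leads; these are rewritten by induction. *)
Lemma monomial_standard_form m :
  exists g : S, (forall m', U m' -> g@_m' = 0) /\
    forall P : point, P \in X -> g.@[P] = ('X_[m] : S).@[P].
Proof.
elim/graded_order_ind: m => m IH.
have [/U_lead [f [mf mmax] fX]|nUm] := boolP (U m); last first.
  exists 'X_[m]; split=> // m' Um'; rewrite mcoeffX.
  by case: eqP Um' nUm => // -> ->.
have /choice [g gP] (m' : 'X_{1..s}) : exists g : S,
    m' \in msupp f -> m' != m -> (forall m'', U m'' -> g@_m'' = 0) /\
    forall P : point, P \in X -> g.@[P] = ('X_[m'] : S).@[P].
  have [/andP[m'f nm'm]|h] := boolP ((m' \in msupp f) && (m' != m)).
    by have [g gP] := IH m' (mmax _ m'f) nm'm; exists g.
  by exists 0 => m'f nm'm; rewrite m'f nm'm in h.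
(* The relation f = 0 on X, solved for the leading monomial, with each lower monomial replaced by
   its standard form. *)
exists (- (f@_m)^-1 *: \sum_(m' <- msupp f | m' != m) f@_m' *: g m'); split.
  move=> m' Um'; rewrite mcoeffZ raddf_sum big_seq_cond big1 ?mulr0 //.
  by move=> m1 /andP[/gP h /h [gU _]]; rewrite /= mcoeffZ gU // mulr0.
move=> P PX; have := fX _ PX; rewrite {1}[f]mpolyE raddf_sum /=.
rewrite (bigD1_seq m) ?msupp_uniq //= mevalZ addrC => /eqP.
rewrite addr_eq0 => /eqP sumE; rewrite mevalZ raddf_sum /=.
rewrite big_seq_cond (eq_bigr (fun m' => (f@_m' *: 'X_[m'] : S).@[P])).
  rewrite -big_seq_cond sumE mulrNN mulrA mulVf ?mul1r //.
  by rewrite -mcoeff_msupp.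
by move=> m1 /andP[/gP h /h [_ gX]]; rewrite !mevalZ gX.
Qed.

Lemma standard_form (f : S) :
  exists g : S, (forall m', U m' -> g@_m' = 0) /\
    forall P : point, P \in X -> g.@[P] = f.@[P].
Proof.
have /choice [g gP] := monomial_standard_form.
exists (\sum_(m <- msupp f) f@_m *: g m); split.
  move=> m' Um'; rewrite raddf_sum big1 // => m _.
  by rewrite /= mcoeffZ (gP m).1 // mulr0.
move=> P PX; rewrite [in RHS](mpolyE f) !raddf_sum; apply: eq_bigr => m _ /=.
by rewrite !mevalZ (gP m).2.
Qed.

(** The standard monomials span all functions on X, a space of dimension [#|X|]. *)
Lemma card_le_standard_monomials (B : nat) :
  (forall m, (B <= mdeg m)%N -> U m) ->
  (#|X| <= #|[set m : 'X_{1..s < B} | ~~ U (bmnm m)]%SET|)%N.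
Proof.
move=> U_large; set N := [set m | _]%SET.
have /choice [f fP] (P : point) : exists f : S,
    (forall m', U m' -> f@_m' = 0) /\
    forall Q : point, Q \in X -> f.@[Q] = (P == Q)%:R.
  have [h hP] := mpoly_interpolation (fun Q => (P == Q)%:R : K).
  have [g [gU gX]] := standard_form h.
  by exists g; split=> // Q QX; rewrite gX // hP.
(* [A] holds the coefficients of the standard forms of the point indicators, [E] the values of the
   standard monomials on X. Their product is the identity of size [#|X|], which factors through
   [#|N|]. *)
pose A := \matrix_(i < #|X|, j < #|N|)
  (f (enum_val i))@_(enum_val j : 'X_{1..s < B}).
pose E := \matrix_(j < #|N|, i < #|X|)
  ('X_[(enum_val j : 'X_{1..s < B})] : S).@[(enum_val i : point)].
apply: (@mulmx1_min K _ _ A E); apply/matrixP => i j; rewrite !mxE.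
have [fU fX] := fP (enum_val i).
rewrite -(inj_eq enum_val_inj) -fX ?enum_valP //.
have fB : (msize (f (enum_val i)) <= B)%N.
  rewrite msizeE; apply/bigmax_leqP_seq => m mf _; rewrite ltnNge.
  apply/negP => /U_large Um; have := mf.
  by rewrite mcoeff_msupp fU ?eqxx.
rewrite [in RHS](mpolywE fB) raddf_sum /= (bigID (mem N)) /=.
rewrite [X in _ + X]big1 ?addr0 => [|m]; last first.
  by rewrite inE negbK => Um; rewrite mevalZ fU ?mul0r.
rewrite [RHS]big_enum_val; apply: eq_bigr => k _.
by rewrite !mxE mevalZ.
Qed.

End Reduction.
End MonomialOrder.

(** * Leading monomials of a space of polynomials *)

Section LeadMonomialsOfSubspaces.
Variables (K : finFieldType) (s d : nat) (le : rel 'X_{1..s}).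
Hypothesis le_mon : monomial_order le.

Definition lead_monomials (W : {vspace bpoly K s d}) : {set 'X_{1..s < d.+1}} :=
  [set m : 'X_{1..s < d.+1} |
    `[< exists2 w, w \in W & is_lead_mon le (mpoly_of w) m >]]%SET.

Lemma mdeg_msupp_mpoly_of (w : bpoly K s d) (m : 'X_{1..s}) :
  m \in msupp (mpoly_of w) -> (mdeg m < d.+1)%N.
Proof.
rewrite ltnS mcoeff_msupp leqNgt.
by apply: contra => /mcoeff_mpoly_of_eq0 ->.
Qed.

(** Projection to the coefficients at these monomials is injective on W: a nonzero element keeps its
    leading coefficient. *)
Lemma dim_le_card_lead_monomials (W : {vspace bpoly K s d}) :
  (\dim W <= #|lead_monomials W|)%N.
Proof.
pose phi := linfun (coefrow (lead_monomials W) \o @mpoly_of K s d).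
rewrite -(@limg_dim_eq _ _ _ phi W); last first.
  apply/eqP; rewrite -subv0; apply/subvP => w; rewrite memv_cap memv_ker memv0.
  move=> /andP[wW]; rewrite lfunE /= => /eqP w0.
  suff /eqP f0 : mpoly_of w == 0.
    by apply/eqP/ffunP => m; rewrite -mcoeff_mpoly_of f0 mcoeff0 ffunE.
  apply/negPn/negP => /(lead_mon_exists le_mon) [m wm].
  have md := mdeg_msupp_mpoly_of wm.1.
  have := wm.1; rewrite mcoeff_msupp.
  rewrite (@coefrow_eq0 _ _ _ (lead_monomials W) _ (BMultinom md)) ?eqxx //.
  by rewrite inE; apply/asboolP; exists w.
by apply: leq_trans (dimvS (subvf _)) _; rewrite dimvf /dim /= mul1n.
Qed.

Lemma sqfree_space_coef (v : bpoly K s d) (m : 'X_{1..s < d.+1}) :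
  v \in sqfree_space K s d -> m \notin sqfree_monomials s d -> v m = 0.
Proof.
pose Nsq := (~: sqfree_monomials s d)%SET.
pose phi := linfun (coefrow Nsq \o @mpoly_of K s d).
move=> vsq nm; rewrite -mcoeff_mpoly_of.
apply: (@coefrow_eq0 _ _ _ Nsq); last by rewrite inE.
suff /subvP/(_ v vsq) : (sqfree_space K s d <= lker phi)%VS.
  by rewrite memv_ker lfunE /= => /eqP.
apply/span_subvP => _ /mapP [m' m'sq ->].
rewrite memv_ker lfunE /=; apply/eqP/rowP => i; rewrite !mxE mcoeff_mpoly_of ffunE.
case: eqP => // im'; have := enum_valP i.
by rewrite im' inE -mem_enum m'sq.
Qed.

Lemma lead_monomials_sqfree (W : {vspace bpoly K s d}) :
  (W <= sqfree_space K s d)%VS -> lead_monomials W \subset sqfree_monomials s d.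
Proof.
move=> /subvP Wsq; apply/fintype.subsetP => m; rewrite inE => /asboolP [w wW [wm _]].
apply: contraTT wm => /(sqfree_space_coef (Wsq _ wW)) w0.
by rewrite mcoeff_msupp mcoeff_mpoly_of w0 eqxx.
Qed.

End LeadMonomialsOfSubspaces.

(** * The footprint bound on the torus *)

Section Footprint.
Variables (K : finFieldType) (s : nat) (le : rel 'X_{1..s}).
Hypotheses (le_mon : monomial_order le) (le_gr : graded le).
Local Notation S := {mpoly K[s]}.
Local Notation point := {ffun 'I_s -> K}.

(** The polynomial is t_i^(q-1) - 1; since q > 1 its first term is not constant and so leads. *)
Lemma torus_lead_mon (i : 'I_s) :
  exists2 f : S, vanishing_ideal (affine_torus K s) f &
    is_lead_mon le f (U_(i) *+ #|K|.-1)%MM.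
Proof.
have [_ _ le_tot le0 _] := le_mon.
have q_gt1 := card_finNzRing_gt1 K.
set m := (_ *+ _)%MM.
have m0 : m != 0%MM.
  rewrite -mdeg_eq0 /m mdegMn mdeg1 mul1n.
  by rewrite -subn1 subn_eq0 -ltnNge.
exists ('X_[m] - 1).
  move=> P; rewrite inE => /forallP Pnz; rewrite mevalB meval1 /m -mpolyXn.
  rewrite rmorphXn /= mevalXU; apply/eqP; rewrite subr_eq0; apply/eqP.
  by apply: (mulfI (Pnz i)); rewrite -exprS prednK 1?ltnW // expf_card mulr1.
split=> [|m' /msuppB_le].
  by rewrite mcoeff_msupp mcoeffB mcoeffX eqxx mcoeff1 (negbTE m0) subr0 oner_eq0.
rewrite mem_cat msuppX msupp1 !inE => /orP[|] /eqP -> //.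
by have := le_tot m m; rewrite orbb.
Qed.

(** Each monomial of the ideal is a multiple of a leading monomial of some polynomial vanishing on
    X: for in(I) because X lies in the torus, for M by assumption. *)
Lemma card_zeros_le_degree (d : nat) (M : {set 'X_{1..s < d.+1}})
    (X : {set point}) :
  X \subset affine_torus K s ->
  (forall m, m \in M -> exists2 f : S, is_lead_mon le f (bmnm m) &
      forall P, P \in X -> f.@[P] = 0) ->
  #|X|%:R <= degree (ideal_gen
    (initial_ideal le (vanishing_ideal (affine_torus K s))
      `|` monomials_of M)%classic).
Proof.
move=> XT Mlead; set I := vanishing_ideal _.
pose A1 : set 'X_{1..s} := [set a | exists2 f : S, I f & is_lead_mon le f a]%classic.
pose A : set 'X_{1..s} := (A1 `|` [set a | exists2 m, m \in M & a = bmnm m])%classic.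
pose U m := `[< exists2 a, A a & (a <= m)%MM >].
have initE (f : S) : initial_ideal le I f <->
    forall m, m \in msupp f -> exists2 a, A1 a & (a <= m)%MM.
  apply: ideal_gen_monomials => [a [g Ig ga]|g [f1 [m [If1 f1m ->]]] m'].
    by exists g, a.
  by rewrite msuppX inE => /eqP ->; exists m; [exists f1 | exact: lepm_refl].
have JE (f : S) : ideal_gen (initial_ideal le I `|` monomials_of M)%classic f <->
    forall m, m \in msupp f -> U m.
  have -> : (forall m, m \in msupp f -> U m) <->
      (forall m, m \in msupp f -> exists2 a, A a & (a <= m)%MM).
    by split=> h m /h /asboolP.
  apply: ideal_gen_monomials => [a [A1a|[m mM ->]]|g [/initE gA|[m mM ->]] m'].
  - left; apply/initE => m; rewrite msuppX inE => /eqP ->.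
    by exists a => //; exact: lepm_refl.
  - by right; exists m.
  - by move=> /gA [a A1a am]; exists a => //; left.
  rewrite msuppX inE => /eqP ->; exists (bmnm m); last exact: lepm_refl.
  by right; exists m.
have U_add m1 m2 : U m1 -> U (m1 + m2)%MM.
  move=> /asboolP [a Aa am]; apply/asboolP; exists a => //.
  exact: lepm_trans am (lem_addr _ _).
(* In degree at least [B] some exponent reaches q-1, so t_i^(q-1) divides the monomial. The
   successor covers s = 0, where the monomial 1 must stay below the bound. *)
pose B := (s * #|K|.-1).+1.
have U_large m : (B <= mdeg m)%N -> U m.
  move=> Bm; have [i im] : exists i, (#|K|.-1 <= m i)%N.
    apply/existsP; apply: contraLR Bm; rewrite negb_exists => /forallP h.
    rewrite -ltnNge ltnS mdegE -[X in (_ <= X * _)%N]card_ord -sum_nat_const.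
    by apply: leq_sum => i _; rewrite ltnW // ltnNge.
  have [f If fm] := torus_lead_mon i; apply/asboolP.
  exists (U_(i) *+ #|K|.-1)%MM; first by left; exists f.
  apply/mnm_lepP => j; rewrite mulmnE mnm1E.
  by case: eqP => [<-|_]; rewrite ?mul1n ?mul0n.
rewrite (degree_monomial_ideal JE U_add U_large) ler_nat.
apply: (card_le_standard_monomials le_mon le_gr) => // m /asboolP [a Aa am].
suff [f fa fX] : exists2 f : S, is_lead_mon le f a & forall P, P \in X -> f.@[P] = 0.
  exists (f * 'X_[m - a]).
    by have := lead_monMX le_mon (m - a)%MM fa; rewrite addmC submK.
  by move=> P PX; rewrite mevalM fX ?mul0r.
case: Aa => [[f If fa]|[m0 /Mlead [f fm fX] ->]]; last by exists f.
by exists f => // P /(fintype.subsetP XT) /If.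
Qed.

Lemma footprint_le_code_support (d : nat)
    (D : {vspace 'rV[K]_#|affine_torus K s|}) :
  (D <= sqfree_code (affine_torus K s) d)%VS ->
  sqfree_footprint le (vanishing_ideal (affine_torus K s)) d (\dim D)
    <= #|code_support D|%:R.
Proof.
move=> DC; set T := affine_torus K s.
pose ev := linfun (@evaluation K s T d).
(* Evaluation maps W onto D, so W has dimension at least that of D, whatever the kernel. *)
pose W := (sqfree_space K s d :&: ev @^-1: D)%VS.
have DW : (D <= ev @: W)%VS.
  apply/subvP => v vD; have /subvP/(_ v vD) /memv_imgP [u uS vE] := DC.
  by rewrite vE memv_img // memv_cap uS -memv_preim -vE.
have card_le : (\dim D <= #|lead_monomials le W|)%N.
  apply: leq_trans (dim_le_card_lead_monomials le_mon W).
  by apply: leq_trans (dimvS DW) _; rewrite -(limg_ker_dim ev W) leq_addl.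
(* Any choice of [\dim D] leading monomials will do. *)
pose M := [set m in take (\dim D) (enum (lead_monomials le W))]%SET.
have ML : M \subset lead_monomials le W.
  by apply/fintype.subsetP => m; rewrite inE => /mem_take; rewrite mem_enum.
have cardM : #|M| = \dim D.
  by rewrite cardsE (card_uniqP (take_uniq _ (enum_uniq _))) size_takel -?cardE.
pose X : {set point} := [set enum_val i | i in ~: code_support D]%SET.
have XT : X \subset T.
  by apply/fintype.subsetP => _ /imsetP [i _ ->]; exact: enum_valP.
have cardX : (#|T| - #|code_support D| = #|X|)%N.
  rewrite card_imset; last exact: enum_val_inj.
  have cardD : (#|code_support D| + #|~: code_support D|%SET)%N = #|T|.
    by rewrite cardsC card_ord.
  exact: etrans (congr1 (subn^~ _) (esym cardD)) (addKn _ _).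
have Mlead m : m \in M -> exists2 f : S, is_lead_mon le f (bmnm m) &
    forall P, P \in X -> f.@[P] = 0.
  move=> /(fintype.subsetP ML); rewrite inE => /asboolP [w wW wm].
  exists (mpoly_of w) => // _ /imsetP [i iD ->].
  move: wW; rewrite memv_cap -memv_preim lfunE /= => /andP[_ evD].
  (* A nonzero value at position i would put i in the support of D. *)
  apply/eqP; apply: contraTT iD => nz; rewrite inE negbK inE.
  by apply/existsP; exists (evaluation T w); rewrite evD mxE.
have T1 : [ffun=> 1] \in T.
  by rewrite inE; apply/forallP => i; rewrite ffunE oner_neq0.
have MP : (M \subset sqfree_monomials s d) && (#|M| == \dim D).
  rewrite cardM eqxx andbT; apply: fintype.subset_trans ML _.
  by apply: lead_monomials_sqfree; exact: capvSl.
have cardDT : (#|code_support D| <= #|T|)%N.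
  by rewrite -[X in (_ <= X)%N]card_ord max_card.
rewrite /sqfree_footprint (degree_vanishing_ideal T1) lerBlDl -lerBlDr.
rewrite -natrB // cardX; apply: le_trans (card_zeros_le_degree XT Mlead) _.
exact: (le_bigmax_cond 0 (fun M0 => degree (ideal_gen
  (initial_ideal le (vanishing_ideal T) `|` monomials_of M0)%classic)) MP).
Qed.

(** Bounds the footprint by the default value of the minimum in [gen_hamming_weight]. The subtracted
    maximum is nonnegative, its own default being 0. *)
Lemma footprint_le_card_torus (d r : nat) :
  sqfree_footprint le (vanishing_ideal (affine_torus K s)) d r
    <= #|affine_torus K s|%:R.
Proof.
have T1 : [ffun=> 1] \in affine_torus K s.
  by rewrite inE; apply/forallP => i; rewrite ffunE oner_neq0.
by rewrite /sqfree_footprint (degree_vanishing_ideal T1) lerBlDr lerDl bigmax_ge_id.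
Qed.

End Footprint.

Theorem corollary5p4 (K : finFieldType) (s : nat) (le : rel 'X_{1..s})
    (d r : nat) :
  (3 <= #|K|)%N ->
  monomial_order le -> graded le ->
  (1 <= d)%N ->
  (1 <= r <= \dim (sqfree_code (affine_torus K s) d))%N ->
  sqfree_footprint le (vanishing_ideal (affine_torus K s)) d r
    <= (gen_hamming_weight (sqfree_code (affine_torus K s) d) r)%:R.
Proof.
move=> _ le_mon le_gr _ _; rewrite /gen_hamming_weight.
(* The lower bound passes to a minimum once it holds for the default and for each support size. *)
apply: (big_ind (fun w : nat => sqfree_footprint le
    (vanishing_ideal (affine_torus K s)) d r <= w%:R)) => [|x y hx hy|w].
- exact: footprint_le_card_torus.
- by rewrite /minn; case: ifP.
by move=> /asboolP [D [DC <- <-]]; exact: footprint_le_code_support.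
Qed.
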